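(* Let $f,g:\mathbb{N}\to\mathbb{C}$ be arithmetic functions satisfying the Ramanujan Conjecture, i.e. $f(n)\ll_{\varepsilon} n^{\varepsilon}$ and $g(n)\ll_{\varepsilon} n^{\varepsilon}$ for every $\varepsilon>0$. Let $g'=g\ast\mu$ be the Eratosthenes transform of $g$ (so $g(m)=\sum_{q\mid m}g'(q)$), fix $N\in\mathbb{N}$, and define the $N$-truncated divisor sum $g_N(m)=\sum_{q\mid m,\,q\le N}g'(q)$ and the coefficients $\hat g(\ell)=\sum_{q\le N,\ q\equiv 0 \bmod \ell}\frac{g'(q)}{q}$. Assume that the correlation $a\mapsto C_{f,g_N}(N,a)$ is fair and satisfies the Delange Hypothesis $$\sum_{d=1}^{\infty}\frac{2^{\omega(d)}}{d}\left|C'_{f,g_N}(N,d)\right|<\infty,\qquad C'_{f,g_N}(N,\ell)=\sum_{t\mid \ell}C_{f,g_N}(N,t)\,\mu\!\left(\frac{\ell}{t}\right).$$ Then, uniformly in $a\in\mathbb{N}$, $$C_{f,g}(N,a)=\sum_{\ell\le N}\left(\frac{\hat g(\ell)}{\varphi(\ell)}\sum_{n\le N}f(n)c_{\ell}(n)\right)c_{\ell}(a)+O_{\varepsilon}\!\left(N^{\varepsilon}(N+a)^{\varepsilon}a\right)$$ for every $\varepsilon>0$.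
   Context: For arithmetic functions $f,h:\mathbb{N}\to\mathbb{C}$, the correlation of shift $a\in\mathbb{N}$ is $C_{f,h}(N,a)=\sum_{n\le N}f(n)h(n+a)$. The Ramanujan sum is $c_{\ell}(n)=\sum_{j\le \ell,\,(j,\ell)=1}e^{2\pi i jn/\ell}$. $\mu$ is the Möbius function, $\ast$ Dirichlet convolution, $\varphi$ Euler's function, $\omega(d)$ the number of distinct prime factors of $d$. A correlation $C_{f,h}(N,a)$ is called fair when its dependence on the shift $a$ occurs only through the argument $n+a$ of $h$: the functions $f$, $h$ (and the coefficients $h'$, $\hat h$) as well as their supports do not depend on $a$. The implied constant in the $O_\varepsilon$ depends only on $\varepsilon$ (and on the constants in the Ramanujan Conjecture bounds for $f,g$ and $g'$). *)

(* Defs.v *)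
From mathcomp Require Import all_boot all_order all_algebra.
From mathcomp Require Import all_classical all_reals all_analysis.
From mathcomp Require Export complex.

Set Implicit Arguments.
Unset Strict Implicit.
Unset Printing Implicit Defensive.

Import Order.TTheory GRing.Theory Num.Theory.

Local Open Scope ring_scope.
Local Open Scope complex_scope.

(* Arithmetic functions are modelled as nat -> R[i]; the value at 0 is junk and
   is never used: every sum below only evaluates them at positive arguments. *)

Notation cabs z := (Normc.normc z).

(* The implied constants A(e) are named, so that uniformity in f can be
   expressed; f satisfies the Ramanujan Conjecture iff some A exists. *)
Definition ramanujan_conjecture_with (R : realType) (A : R -> R)
    (f : nat -> R[i]) : Prop :=
  forall e : R, 0 < e ->
  forall n : nat, (0 < n)%N -> cabs (f n) <= A e * n%:R `^ e.

Definition omega (n : nat) : nat := size (primes n).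

Definition moebius (R : realType) (n : nat) : R[i] :=
  if (0 < n)%N && all (fun p => logn p n == 1%N) (primes n)
  then (-1) ^+ omega n else 0.

Definition dirichlet_conv (R : realType) (u v : nat -> R[i]) (n : nat) : R[i] :=
  \sum_(d <- divisors n) u d * v (n %/ d)%N.

Definition eratosthenes (R : realType) (g : nat -> R[i]) : nat -> R[i] :=
  dirichlet_conv g (@moebius R).

(* c_l(n), with e^{i t} written as cos t + i sin t *)
Definition ramanujan_sum (R : realType) (l n : nat) : R[i] :=
  \sum_(1 <= j < l.+1 | coprime j l)
    (cos (2 * pi * j%:R * n%:R / l%:R) +i* sin (2 * pi * j%:R * n%:R / l%:R)).

(* C_{f,h}(N,a).  As f and h are fixed functions that do not take the shift a
   as an argument, a occurs only in h (n + a): the correlation is fair. *)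
Definition correlation (R : realType) (f h : nat -> R[i]) (N a : nat) : R[i] :=
  \sum_(1 <= n < N.+1) f n * h (n + a)%N.

Definition truncated_divisor_sum (R : realType) (g : nat -> R[i]) (N m : nat)
    : R[i] :=
  \sum_(q <- divisors m | (q <= N)%N) eratosthenes g q.

(* \hat g(l), which depends on the truncation level N *)
Definition ramanujan_coef (R : realType) (g : nat -> R[i]) (N l : nat) : R[i] :=
  \sum_(1 <= q < N.+1 | (l %| q)%N) eratosthenes g q / q%:R.

(* C'_{f,h}(N,l): the Eratosthenes transform with respect to the shift *)
Definition correlation' (R : realType) (f h : nat -> R[i]) (N : nat)
    : nat -> R[i] :=
  eratosthenes (correlation f h N).

Definition delange_hypothesis (R : realType) (f h : nat -> R[i]) (N : nat)
    : Prop :=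
  (\sum_(1 <= d <oo)
     ((2 ^ omega d)%:R / d%:R * cabs (correlation' f h N d))%:E < +oo :> \bar R)%E.

(* Main.v *)
Require Import Defs.
From mathcomp Require Import all_boot all_order all_algebra.
From mathcomp Require Import all_classical all_reals all_analysis.
From mathcomp Require Import ring lra.
Import Order.TTheory GRing.Theory Num.Theory.
Local Open Scope ring_scope.

(* Let F(a) = C_{f,g_N}(N,a), which is periodic modulo L = N! since
   g_N(m) = sum_l \hat g(l) c_l(m).  The Delange hypothesis makes the sum of |F'(d)| / d
   finite, where F' = F * mu, and averaging F over long progressions modulo L then shows that
   F(u a) = F(a) for every u coprime to L.  Averaging over these u replaces
   c_l(n + u a) by c_l(n) c_l(a) / phi(l), so F equals the Ramanujan expansion of
   the theorem exactly.  The error is C_{f,g} - C_{f,g_N}: each of the a integers q in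
   (N, N + a] divides n + a for at most one n <= N, and g'(q) << q^eps by the
   divisor bound. *)

(** * Divisor sums and Möbius inversion *)

(** Trades the list of divisors for a range with any bound [M >= n], so that sums for several [n]
    share one range and can be exchanged. *)
Lemma sum_divisors (V : nmodType) (n M : nat) (P : pred nat) (h : nat -> V) :
  (0 < n <= M)%N ->
  \sum_(d <- divisors n | P d) h d = \sum_(1 <= d < M.+1 | (d %| n)%N && P d) h d.
Proof.
move=> /andP[n_gt0 leM]; rewrite -big_filter -[RHS]big_filter.
apply: perm_big; apply: uniq_perm.
- by rewrite filter_uniq ?divisors_uniq.
- by rewrite filter_uniq ?iota_uniq.
move=> d; rewrite !mem_filter -dvdn_divisors // mem_index_iota andbC.
case dn: (d %| n)%N => //=.
by rewrite ltnS (dvdn_gt0 n_gt0 dn) (leq_trans (dvdn_leq n_gt0 dn) leM) !andbT.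
Qed.

Lemma moebius_mul_prime (R : realType) (p d : nat) :
  prime p -> (0 < d)%N -> ~~ (p %| d)%N -> moebius R (p * d) = - moebius R d.
Proof.
move=> p_pr d_gt0 pd; rewrite /moebius d_gt0 muln_gt0 (prime_gt0 p_pr) d_gt0 /=.
have p_notin : p \notin primes d by rewrite mem_primes p_pr d_gt0.
have perm_primes : perm_eq (primes (p * d)) (p :: primes d).
  apply: uniq_perm; rewrite ?primes_uniq //= ?p_notin ?primes_uniq //.
  by move=> q; rewrite (primesM _ (prime_gt0 p_pr) d_gt0) primes_prime // !inE.
rewrite (perm_all _ perm_primes) /omega (perm_size perm_primes) /= exprS mulN1r.
rewrite (lognM _ (prime_gt0 p_pr) d_gt0) logn_prime // eqxx lognE p_pr d_gt0 (negbTE pd) /=.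
have -> : all (fun q => logn q (p * d) == 1%N) (primes d)
    = all (fun q => logn q d == 1%N) (primes d).
  apply: eq_in_all => q qd; rewrite (lognM _ (prime_gt0 p_pr) d_gt0) logn_prime //.
  by have /negbTE -> : q != p by apply: contraNneq p_notin => <-.
by case: ifP; rewrite ?oppr0.
Qed.

Lemma moebius_eq0 (R : realType) (p d : nat) :
  (1 < logn p d)%N -> moebius R d = 0.
Proof.
move=> lp; rewrite /moebius; case: ifP => // /andP[d_gt0 /allP sqf].
have: p \in primes d by rewrite -logn_gt0 ltnW.
by move=> /sqf /eqP lp1; rewrite lp1 in lp.
Qed.

(* The divisors d with p | d cancel against those without, through d -> p d. *)
Lemma sum_moebius (R : realType) (n : nat) : (0 < n)%N ->
  \sum_(d <- divisors n) moebius R d = (n == 1)%N%:R.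
Proof.
move=> n_gt0; have [->|n_neq1] := eqVneq n 1%N.
  by rewrite /divisors /= big_seq1 /moebius.
set p := pdiv n.
have p_pr : prime p by rewrite pdiv_prime // ltn_neqAle eq_sym n_neq1.
have p_gt0 := prime_gt0 p_pr.
(* Three classes by the exponent of [p] in [d]: 0 and 1 are matched below, and exponents at least 2
   contribute nothing because [d] is not squarefree. *)
rewrite (bigID (fun d => logn p d == 0)%N) /= addrC (bigID (fun d => logn p d == 1)%N) /=.
rewrite [X in _ + X + _]big1 ?addr0; last first.
  by move=> d /andP[l0 l1]; apply: (@moebius_eq0 _ p); case: (logn p d) l0 l1 => [|[]].
rewrite -big_filter (perm_big [seq (p * d)%N | d <- [seq d <- divisors n | logn p d == 0%N]]).
  rewrite big_map -[X in _ + X]big_filter -big_split /=.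
  rewrite big_seq_cond big1 // => d; rewrite andbT mem_filter -dvdn_divisors // => /andP[ld dn].
  have d_gt0 := dvdn_gt0 n_gt0 dn.
  by rewrite moebius_mul_prime ?addNr // -(expn1 p) pfactor_dvdn // (eqP ld).
apply: uniq_perm.
- by rewrite filter_uniq ?divisors_uniq.
- rewrite map_inj_uniq ?filter_uniq ?divisors_uniq // => x y /eqP.
  by rewrite eqn_pmul2l // => /eqP.
move=> d; rewrite mem_filter -dvdn_divisors //; apply/idP/mapP.
  move=> /andP[/andP[_ /eqP ld] dn]; have d_gt0 := dvdn_gt0 n_gt0 dn.
  have /dvdnP[e de] : (p %| d)%N by rewrite -(expn1 p) pfactor_dvdn // ld.
  exists e; last by rewrite mulnC.
  have e_gt0 : (0 < e)%N by move: d_gt0; rewrite de muln_gt0 => /andP[].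
  rewrite mem_filter -dvdn_divisors // (dvdn_trans _ dn) ?de ?dvdn_mulr // andbT.
  by move: ld; rewrite de lognM // (logn_prime _ p_pr) eqxx addn1 => -[->].
move=> [e]; rewrite mem_filter -dvdn_divisors // => /andP[/eqP le en] ->.
have e_gt0 := dvdn_gt0 n_gt0 en.
rewrite lognM // (logn_prime _ p_pr) eqxx le /= Gauss_dvd ?pdiv_dvd ?en //.
by rewrite prime_coprime // -(expn1 p) pfactor_dvdn // le.
Qed.

(** Möbius inversion. After the exchange of sums, the [d] with [e | d | n] are the [k e] with
    [k | n / e], so the coefficient of [g e] is a full Möbius sum over [n / e] and survives only for
    [e = n]. *)
Lemma sum_eratosthenes (R : realType) (g : nat -> R[i]) (n : nat) : (0 < n)%N ->
  \sum_(d <- divisors n) eratosthenes g d = g n.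
Proof.
move=> n_gt0; rewrite /eratosthenes /dirichlet_conv.
transitivity (\sum_(d <- divisors n) \sum_(e <- divisors n | (e %| d)%N)
    g e * moebius R (d %/ e)).
  rewrite big_seq [RHS]big_seq; apply: eq_bigr => d; rewrite -dvdn_divisors // => dn.
  have d_gt0 := dvdn_gt0 n_gt0 dn; have dle := dvdn_leq n_gt0 dn.
  rewrite (@sum_divisors _ d n) ?d_gt0 // (@sum_divisors _ n n) ?n_gt0 ?leqnn //.
  apply: eq_bigl => e; rewrite andbT; case ed: (e %| d)%N; rewrite ?andbF //.
  by rewrite (dvdn_trans ed dn).
rewrite (exchange_big_dep xpredT) //=.
transitivity (\sum_(e <- divisors n) g e * (n == e)%:R).
  rewrite big_seq [RHS]big_seq; apply: eq_bigr => e; rewrite -dvdn_divisors // => en.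
  have e_gt0 := dvdn_gt0 n_gt0 en.
  rewrite -big_distrr /= -big_filter; congr (_ * _).
  rewrite (perm_big [seq (k * e)%N | k <- divisors (n %/ e)]).
    rewrite big_map; under eq_bigr do rewrite mulnK //.
    rewrite sum_moebius ?divn_gt0 ?(dvdn_leq n_gt0 en) //.
    by rewrite eq_sym eqn_div // mul1n eq_sym.
  have ne_gt0 : (0 < n %/ e)%N by rewrite divn_gt0 // (dvdn_leq n_gt0 en).
  apply: uniq_perm.
  - by rewrite filter_uniq ?divisors_uniq.
  - rewrite map_inj_uniq ?divisors_uniq // => x y /eqP.
    by rewrite eqn_pmul2r // => /eqP.
  move=> d; rewrite mem_filter -dvdn_divisors //; apply/idP/mapP.
    move=> /andP[/dvdnP[k ->] dn]; exists k => //.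
    by rewrite -dvdn_divisors // dvdn_divRL.
  by move=> [k]; rewrite -dvdn_divisors // dvdn_divRL // => kn ->; rewrite dvdn_mull.
rewrite (bigD1_seq n) ?divisors_id ?divisors_uniq //= eqxx mulr1 big1 ?addr0 //.
by move=> e; rewrite eq_sym => /negbTE ->; rewrite mulr0.
Qed.

(** * The divisor bound *)

(** [divisors] folds over the prime decomposition; for a prime of exponent [e] it performs [e]
    merges, each adding one more copy of the length of the list built so far. *)
Lemma size_divisors (n : nat) : (0 < n)%N ->
  size (divisors n) = (\prod_(p <- primes n) (logn p n).+1)%N.
Proof.
move=> n_gt0.
rewrite /divisors prime_decompE; elim: (primes n) => [|p s IHs] /=.
  by rewrite big_nil.
rewrite big_cons -IHs; set ds := foldr _ _ _.
have: forall e m (ds' := iter e (fun ds0 => merge leq [seq NatTrec.mul p i | i <- ds0] ds) m),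
   size ds' = (size m + e * size ds)%N.
  elim=> [|e IH] m /=; first by rewrite addn0.
  by rewrite size_merge size_cat size_map IH mulSnr addnA.
by move=> ->; rewrite mulSn.
Qed.

(** Bernoulli's inequality: with [b = 1 + t], [b ^+ k >= 1 + k t], and the factor [1 + 1 / t] turns
    the right side into at least [k + 1]. *)
Lemma succ_le_geometric (R : realType) (e : R) : 0 < e ->
  exists2 C : R, 1 <= C & forall k : nat, k.+1%:R <= C * (2%:R `^ e) ^+ k.
Proof.
move=> e_gt0; set b := 2%:R `^ e.
have b_gt1 : 1 < b.
  rewrite -(powRr0 (2%:R : R)) /b /powR !pnatr_eq0 /= ltr_expR ltr_pM2r // ln_gt0 //.
  by rewrite (ltr_nat R 1 2).
set t := b - 1; have t_gt0 : 0 < t by rewrite subr_gt0.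
have bern k : 1 + k%:R * t <= b ^+ k.
  elim: k => [|k IH]; first by rewrite mul0r addr0 expr0.
  rewrite exprS (le_trans _ (ler_wpM2l _ IH)) ?(ltW (lt_trans ltr01 b_gt1)) //.
  have -> : b = 1 + t by rewrite /t; ring.
  have k0 : 0 <= k%:R * t * t by rewrite !mulr_ge0 ?ler0n // ltW.
  by rewrite -natr1; nra.
exists (1 + t^-1) => [|k]; first by rewrite lerDl invr_ge0 ltW.
apply: le_trans (ler_wpM2l _ (bern k)); last by rewrite addr_ge0 // invr_ge0 ltW.
have -> : (1 + t^-1) * (1 + k%:R * t) = 1 + k%:R * t + t^-1 + k%:R.
  by field; rewrite gt_eqF.
rewrite -natr1.
have : 0 <= t^-1 by rewrite invr_ge0 ltW.
have : 0 <= k%:R * t by rewrite mulr_ge0 ?ler0n // ltW.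
lra.
Qed.

(* For p >= 2^(1/e) the Euler factor (k+1) / p^(k e) is at most (k+1) / 2^k <= 1;
   each of the finitely many smaller primes costs at most a constant factor. *)
Lemma divisor_bound (R : realType) (e : R) : 0 < e ->
  exists2 C : R, 0 <= C &
    forall n : nat, (0 < n)%N -> (size (divisors n))%:R <= C * n%:R `^ e.
Proof.
move=> e_gt0; have [C C_ge1 CP] := succ_le_geometric R e e_gt0.
have C_ge0 : 0 <= C by exact: le_trans ler01 C_ge1.
(* Any [p >= P] exceeds [2 ^ (1 / e)], hence [p ^ e >= 2]. *)
pose P := (Num.truncn (2%:R `^ e^-1 : R)).+1.
have P_lt : (2%:R `^ e^-1 : R) < P%:R by rewrite truncnS_gt.
exists (C ^+ P) => [|n n_gt0]; first exact: exprn_ge0.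
rewrite size_divisors // natr_prod.
have factor p k : (0 < p)%N -> prime p ->
    k.+1%:R <= (if (p < P)%N then C else 1) * (p%:R `^ e) ^+ k :> R.
  move=> p_gt0 p_pr; case: ltnP => pP.
    apply: (le_trans (CP k)); rewrite ler_wpM2l // lerXn2r ?nnegrE ?powR_ge0 //.
    by rewrite ge0_ler_powR ?nnegrE ?ler0n ?(ltW e_gt0) // ler_nat prime_gt1.
  rewrite mul1r; apply: (@le_trans _ _ (2%:R ^+ k)).
    by rewrite -natrX ler_nat ltn_expl.
  rewrite lerXn2r ?nnegrE ?powR_ge0 ?ler0n //.
  have -> : 2%:R = (2%:R `^ e^-1) `^ e :> R.
    by rewrite -powRrM mulVf ?gt_eqF // powRr1 // ler0n.
  rewrite ge0_ler_powR ?nnegrE ?ler0n ?powR_ge0 ?(ltW e_gt0) //.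
  by rewrite (le_trans (ltW P_lt)) // ler_nat.
have n_eq : n%:R `^ e = \prod_(p <- primes n) ((p%:R `^ e) ^+ logn p n) :> R.
  rewrite {1}(prod_prime_decomp n_gt0) prime_decompE big_map /= natr_prod.
  elim: (primes n) => [|p s IHs]; first by rewrite !big_nil powR1.
  rewrite !big_cons powRM ?ler0n //; last by apply: prodr_ge0 => *; exact: ler0n.
  by rewrite IHs natrX -!powR_mulrn ?powR_ge0 ?ler0n // powRAC.
rewrite n_eq.
apply: (@le_trans _ _ (\prod_(p <- primes n)
    ((if (p < P)%N then C else 1) * (p%:R `^ e) ^+ logn p n))).
  rewrite big_seq [leRHS]big_seq; apply: ler_prod => p.
  by rewrite mem_primes => /andP[p_pr _]; rewrite ler0n /= factor ?prime_gt0.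
rewrite big_split /= ler_wpM2r //.
  by apply: prodr_ge0 => p _; rewrite exprn_ge0 ?powR_ge0.
rewrite -big_mkcond /= -big_filter big_const_seq count_predT iter_mulr_1.
(* At most [P] primes lie below [P], and [C >= 1] allows the exponent to be raised to [P]. *)
apply: ler_weXn2l => //; rewrite -[X in (_ <= X)%N](size_iota 0 P).
apply: uniq_leq_size; first by rewrite filter_uniq ?primes_uniq.
by move=> p; rewrite mem_filter mem_iota => /andP[].
Qed.

(** * Units and complete residue systems *)

(** Take for [t] the part of [L] prime to [j]. A prime [p | L] then divides exactly one of [j] and
    [t]; if it divides [j] it does not divide [l] either, so in both cases [p] misses [j + t l]. *)
Lemma coprime_lift (l j L : nat) : (0 < j)%N -> (0 < L)%N -> coprime j l ->
  exists t : nat, coprime (j + t * l) L.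
Proof.
move=> j_gt0 L_gt0 co_jl; exists (L`_(\pi(j)^'))%N.
set t := (L`_ _)%N; rewrite /coprime; apply/negPn/negP => g_neq1.
have g_gt0 : (0 < gcdn (j + t * l) L)%N by rewrite gcdn_gt0 L_gt0 orbT.
set p := pdiv (gcdn (j + t * l) L).
have p_pr : prime p by rewrite pdiv_prime // ltn_neqAle eq_sym g_neq1.
have /andP[pv pL] : ((p %| j + t * l) && (p %| L))%N by rewrite -dvdn_gcd pdiv_dvd.
have [pj|pj] := boolP (p %| j)%N.
  move: pv; rewrite dvdn_addr // Euclid_dvdM // => /orP[pt|pl].
    have := part_pnat \pi(j)^' L; rewrite -/t => /pnatP.
    rewrite part_gt0 => /(_ isT p p_pr pt).
    by rewrite /= !inE /= mem_primes p_pr j_gt0 pj.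
  have : (p %| gcdn j l)%N by rewrite dvdn_gcd pj pl.
  by rewrite (eqP co_jl) Euclid_dvd1.
have pt : (p %| t)%N.
  move: pL; rewrite -(partnC \pi(j) L_gt0) Euclid_dvdM // => /orP[pjL|//].
  have := part_pnat \pi(j) L => /pnatP.
  rewrite part_gt0 => /(_ isT p p_pr pjL).
  by rewrite /= mem_primes p_pr j_gt0 (negbTE pj).
by move: pv; rewrite dvdn_addl ?(negbTE pj) // dvdn_mulr.
Qed.

(** [v] is invertible modulo [K], so [k -> s + v k] permutes the residues. *)
Lemma sum_affine_mod (V : nmodType) (K s v : nat) (h : nat -> V) :
  (0 < K)%N -> coprime v K ->
  \sum_(k < K) h ((s + v * k) %% K)%N = \sum_(k < K) h k.
Proof.
move=> K_gt0 co_vK.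
pose sigma (k : 'I_K) := Ordinal (ltn_pmod (s + v * k) K_gt0).
rewrite [RHS](reindex_inj (h := sigma)) // => k1 k2 /(congr1 val) /= /eqP.
rewrite eqn_modDl => e12; apply/val_inj; move: e12.
wlog le12 : k1 k2 / (k1 <= k2)%N.
  move=> W; have [|/ltnW] := leqP k1 k2; first exact: W.
  by move=> le21; rewrite eq_sym => /(W _ _ le21).
rewrite eq_sym eqn_mod_dvd ?leq_mul2l ?le12 ?orbT // -mulnBr Gauss_dvdr 1?coprime_sym //.
move=> dvdK; apply/eqP; rewrite eqn_leq le12 -subn_eq0 /=.
by rewrite -(modn_small (leq_ltn_trans (leq_subr k1 k2) (ltn_ord k2))).
Qed.

Lemma sum_shift1 (V : nmodType) (L : nat) (G : nat -> V) : G 0%N = G L ->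
  \sum_(1 <= u < L.+1) G u = \sum_(u < L) G u.
Proof.
move=> G0L; rewrite -(big_mkord xpredT); case: L G0L => [|L] G0L; first by rewrite !big_geq.
by rewrite big_nat_recr //= [RHS]big_ltn // -G0L addrC.
Qed.

(** The endpoints 0 and [L] have the same gcd with [L]; both count as units when [L = 1], which is
    where the values of [h] must agree. *)
Lemma sum_units_ord (V : nmodType) (L : nat) (h : nat -> V) : h 0%N = h L ->
  \sum_(1 <= u < L.+1 | coprime u L) h u
    = \sum_(u < L) (if coprime u L then h u else 0).
Proof.
move=> h0L; rewrite big_mkcond sum_shift1 //=.
by rewrite h0L /coprime gcd0n gcdnn.
Qed.

Lemma sum_units_mul (V : nmodType) (L v : nat) (h : nat -> V) :
  (0 < L)%N -> coprime v L -> (forall u, h (u %% L)%N = h u) ->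
  \sum_(1 <= u < L.+1 | coprime u L) h (v * u)%N
    = \sum_(1 <= u < L.+1 | coprime u L) h u.
Proof.
move=> L_gt0 co_vL hmod.
have h0 k : h (k * L)%N = h 0%N by rewrite -hmod modnMl -hmod mod0n.
rewrite !sum_units_ord; last 2 first.
- by rewrite -(mul1n L) h0.
- by rewrite muln0 h0.
rewrite -[RHS](@sum_affine_mod _ L 0 v (fun u => if coprime u L then h u else 0)) //.
by apply: eq_bigr => u _; rewrite add0n hmod coprime_modl coprimeMl co_vL.
Qed.

Lemma count_units (R : pzRingType) (L : nat) : (0 < L)%N ->
  \sum_(1 <= u < L.+1 | coprime u L) 1 = (totient L)%:R :> R.
Proof.
move=> L_gt0; rewrite sum_units_ord // totient_count_coprime natr_sum.
by rewrite big_mkord; apply: eq_bigr => u _; rewrite coprime_sym; case: coprime.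
Qed.

(** * Roots of unity and Ramanujan sums *)

Definition expi (R : realType) (x : R) : R[i] := Complex (cos x) (sin x).

Lemma expiD (R : realType) (x y : R) : expi R (x + y) = expi R x * expi R y.
Proof.
by apply/eqP; rewrite eq_complex /= cosD sinD; apply/andP; split; apply/eqP; ring.
Qed.

Lemma expiMn (R : realType) (x : R) n : expi R (x *+ n) = expi R x ^+ n.
Proof.
elim: n => [|n IHn]; last by rewrite mulrS expiD IHn exprS.
by rewrite mulr0n expr0 /expi cos0 sin0.
Qed.

Definition root_of_unity (R : realType) (l : nat) : R[i] := expi R (2 * pi / l%:R).

Lemma root_of_unity_expn (R : realType) l : (0 < l)%N -> root_of_unity R l ^+ l = 1.
Proof.
move=> l_gt0; rewrite -expiMn -[X in expi _ X]mulr_natr divfK ?pnatr_eq0 -?lt0n //.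
by rewrite mulr_natl /expi cos2pi sin2pi.
Qed.

Lemma root_of_unity_mod (R : realType) l k : (0 < l)%N ->
  root_of_unity R l ^+ (k %% l) = root_of_unity R l ^+ k.
Proof. by move=> l_gt0; rewrite expr_mod // root_of_unity_expn. Qed.

(** For [0 < r < l] put [x = pi r / l], which lies strictly between 0 and [pi]. If [cos (2 x) = 1]
    then [sin x = 0], against [sin x > 0]. *)
Lemma root_of_unity_eq1 (R : realType) l k : (0 < l)%N ->
  (root_of_unity R l ^+ k == 1) = (l %| k)%N.
Proof.
move=> l_gt0; apply/idP/idP => [|/dvdnP[c ->]]; last first.
  by rewrite mulnC exprM root_of_unity_expn // expr1n.
rewrite -root_of_unity_mod // /dvdn; set r := (k %% l)%N.
have r_lt : (r < l)%N by rewrite ltn_pmod.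
rewrite -expiMn eq_complex /= => /andP[/eqP cos1 _]; apply/negPn/negP.
rewrite -lt0n => r_gt0.
pose x : R := pi * (r%:R / l%:R).
have x_bd : 0 < x < pi.
  have l0 : 0 < l%:R :> R by rewrite ltr0n.
  rewrite mulr_gt0 ?pi_gt0 ?divr_gt0 ?ltr0n //=.
  by rewrite -[ltRHS]mulr1 ltr_pM2l ?pi_gt0 // ltr_pdivrMr // mul1r ltr_nat.
have := sin_gt0_pi x_bd.
have xE : (2 * pi / l%:R) *+ r = x *+ 2 :> R.
  by rewrite /x -[LHS]mulr_natr -[RHS]mulr_natr; ring.
move: cos1; rewrite xE cos_mulr2n => cos1 sin_gt0.
have := cos2Dsin2 x; rewrite -[cos x ^+ 2 *+ 2]mulr_natr in cos1.
have : 0 < sin x ^+ 2 by rewrite exprn_gt0.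
lra.
Qed.

Lemma sum_root_of_unity (R : realType) q m : (0 < q)%N ->
  \sum_(j < q) root_of_unity R q ^+ (j * m) = (if (q %| m)%N then q%:R else 0).
Proof.
move=> q_gt0; set z := root_of_unity R q ^+ m.
under eq_bigr do rewrite mulnC exprM -/z.
rewrite -(root_of_unity_eq1 R) -/z //; have [->|z_neq1] := eqVneq z 1.
  by under eq_bigr do rewrite expr1n; rewrite sumr_const card_ord.
apply/eqP; have := subrX1 z q.
rewrite /z -exprM mulnC exprM root_of_unity_expn // expr1n subrr => /esym/eqP.
by rewrite mulf_eq0 subr_eq0 -/z (negbTE z_neq1).
Qed.

Lemma ramanujan_sumE (R : realType) l n :
  ramanujan_sum R l n
    = \sum_(1 <= j < l.+1 | coprime j l) root_of_unity R l ^+ (j * n).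
Proof.
apply: eq_bigr => j _; rewrite -expiMn /expi.
have -> // : 2 * pi * j%:R * n%:R / l%:R = (2 * pi / l%:R) *+ (j * n) :> R.
by rewrite -[RHS]mulr_natr natrM; ring.
Qed.

Lemma ramanujan_sum_mod (R : realType) l n n' : (0 < l)%N -> (n = n' %[mod l])%N ->
  ramanujan_sum R l n = ramanujan_sum R l n'.
Proof.
move=> l_gt0 enn'; rewrite !ramanujan_sumE; apply: eq_bigr => j _.
by rewrite -root_of_unity_mod // -modnMmr enn' modnMmr root_of_unity_mod.
Qed.

Lemma ramanujan_sum_dvd (R : realType) l n : (0 < l)%N -> (l %| n)%N ->
  ramanujan_sum R l n = (totient l)%:R.
Proof.
move=> l_gt0 ln; rewrite (@ramanujan_sum_mod _ _ n 0%N) ?(eqP ln) ?mod0n // ramanujan_sumE.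
by under eq_bigr do rewrite muln0 expr0; exact: count_units.
Qed.

Lemma ramanujan_sum_unit (R : realType) l u n : (0 < l)%N -> coprime u l ->
  ramanujan_sum R l (u * n) = ramanujan_sum R l n.
Proof.
move=> l_gt0 co_ul; rewrite !ramanujan_sumE.
rewrite -[RHS](@sum_units_mul _ l u (fun j => root_of_unity R l ^+ (j * n))) //.
  by apply: eq_bigr => j _; rewrite mulnCA mulnA.
by move=> j; rewrite -root_of_unity_mod // modnMml root_of_unity_mod.
Qed.

(** Orthogonality over units. Expanding [c_l], the sum over [u] of [z ^ (j u a)] does not depend on
    [j]: lift [j] to a unit [v] modulo [L] and absorb it into [u]. The sum therefore factors as
    [c_l(n) S]. *)
Lemma sum_units_ramanujan_sum (R : realType) (L l n a : nat) :
  (0 < L)%N -> (l %| L)%N ->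
  (totient l)%:R * \sum_(1 <= u < L.+1 | coprime u L) ramanujan_sum R l (n + u * a)
    = (totient L)%:R * ramanujan_sum R l n * ramanujan_sum R l a.
Proof.
move=> L_gt0 lL; have l_gt0 := dvdn_gt0 L_gt0 lL.
pose z := root_of_unity R l.
pose S := \sum_(1 <= u < L.+1 | coprime u L) z ^+ (u * a).
have rotate j : (0 < j)%N -> coprime j l ->
    \sum_(1 <= u < L.+1 | coprime u L) z ^+ (j * (u * a)) = S.
  move=> j_gt0 co_jl; have [t] := coprime_lift _ _ _ j_gt0 L_gt0 co_jl.
  set v := (j + t * l)%N => co_vL.
  have vj : (v = j %[mod l])%N by rewrite /v addnC modnMDl.
  rewrite /S -[RHS](@sum_units_mul _ L v (fun u => z ^+ (u * a))) //.
    apply: eq_bigr => u _; rewrite -mulnA -root_of_unity_mod // -modnMml -vj modnMml.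
    by rewrite root_of_unity_mod.
  move=> u; rewrite -root_of_unity_mod // -modnMml modn_dvdm // modnMml.
  by rewrite root_of_unity_mod.
have split_sum m : \sum_(1 <= u < L.+1 | coprime u L) ramanujan_sum R l (m + u * a)
    = ramanujan_sum R l m * S.
  under eq_bigr do rewrite ramanujan_sumE.
  rewrite exchange_big ramanujan_sumE mulr_suml /=.
  rewrite big_nat_cond [RHS]big_nat_cond.
  apply: eq_bigr => j /andP[/andP[j_gt0 _] co_jl].
  rewrite -(rotate j) // mulr_sumr; apply: eq_bigr => u _.
  by rewrite mulnDr exprD.
(* The case [m = 0] evaluates [S]: there [c_l(0)] is the totient of [l], while every [c_l(u a)]
   equals [c_l(a)]. *)
have := split_sum 0%N.
rewrite (@ramanujan_sum_dvd _ l 0) // => sum0.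
rewrite split_sum mulrCA -sum0 -mulrA mulrCA; congr (_ * _).
rewrite -count_units // mulr_suml; apply: eq_bigr => u co_uL.
by rewrite add0n mul1r ramanujan_sum_unit // (coprime_dvdr lL).
Qed.

(** Sort the fractions [j / q] by their reduced denominator [l = q / gcd(j, q)]. The class of [l]
    sums to [c_l(m)], and all classes together form the full sum over [q]-th roots of unity. *)
Lemma sum_ramanujan_sum_divisors (R : realType) q m : (0 < q)%N ->
  \sum_(l <- divisors q) ramanujan_sum R l m = (if (q %| m)%N then q%:R else 0).
Proof.
move=> q_gt0; rewrite -sum_root_of_unity // -(@sum_shift1 _ q (fun j => root_of_unity R q ^+ (j * m))); last first.
  by rewrite mul0n expr0 exprM root_of_unity_expn // expr1n.
transitivity (\sum_(1 <= j < q.+1) \sum_(l <- divisors q | (l == q %/ gcdn j q)%N)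
   root_of_unity R q ^+ (j * m)); last first.
  rewrite big_nat_cond [RHS]big_nat_cond; apply: eq_bigr => j /andP[/andP[j_gt0 _] _].
  have dv : (q %/ gcdn j q %| q)%N.
    by apply/dvdnP; exists (gcdn j q); rewrite mulnC divnK ?dvdn_gcdr.
  by rewrite -big_filter filter_pred1_uniq ?divisors_uniq -?dvdn_divisors // big_seq1.
rewrite (exchange_big_dep xpredT) //= big_seq [RHS]big_seq.
apply: eq_bigr => l; rewrite -dvdn_divisors // => lq.
have l_gt0 := dvdn_gt0 q_gt0 lq.
have e_gt0 : (0 < q %/ l)%N by rewrite divn_gt0 // dvdn_leq.
have qE := divnK lq; move: (q %/ l)%N e_gt0 qE => e e_gt0 qE.
rewrite -qE in q_gt0 lq *; clear qE.
rewrite ramanujan_sumE -[RHS]big_filter.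
(* With [q = e l], the [j] of reduced denominator [l] are the [i e] with [i <= l] prime to [l], and
   the [e]-th power of the [q]-th root is the [l]-th root. *)
rewrite [RHS](perm_big [seq (i * e)%N | i <- [seq i <- index_iota 1 l.+1 | coprime i l]]).
  rewrite big_map big_filter; apply: eq_bigr => i _.
  have -> : (i * e * m = e * (i * m))%N by rewrite mulnAC mulnC.
  rewrite [RHS]exprM; congr (_ ^+ _).
  rewrite /root_of_unity -expiMn; congr expi.
  rewrite -[RHS]mulr_natr natrM.
  by field; rewrite !pnatr_eq0 -!lt0n l_gt0 e_gt0.
apply: uniq_perm.
- by rewrite filter_uniq ?iota_uniq.
- rewrite map_inj_uniq ?filter_uniq ?iota_uniq // => x y /eqP.
  by rewrite eqn_pmul2r // => /eqP.
move=> j; rewrite mem_filter mem_index_iota; apply/idP/mapP.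
  move=> /andP[/eqP lE /andP[j_gt0 jle]].
  have gE : gcdn j (e * l) = e.
    have := divnK (dvdn_gcdr j (e * l)); rewrite -lE => lgE.
    by apply/eqP; rewrite -(eqn_pmul2r l_gt0) mulnC lgE.
  have /dvdnP[i ji] : (e %| j)%N by rewrite -[X in (X %| _)%N]gE dvdn_gcdl.
  exists i => //; rewrite mem_filter mem_index_iota.
  move: gE j_gt0 jle; rewrite ji [(e * l)%N]mulnC -muln_gcdl muln_gt0.
  move=> /eqP; rewrite -{2}(mul1n e) eqn_pmul2r // /coprime => -> /andP[-> _].
  by rewrite !ltnS leq_pmul2r.
move=> [] i; rewrite mem_filter mem_index_iota => /andP[co_il /andP[i_gt0 ile]] ->.
rewrite muln_gt0 i_gt0 e_gt0 /= [(e * l)%N]mulnC -muln_gcdl.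
by rewrite (eqP co_il) mul1n mulnK // eqxx ltnS leq_pmul2r.
Qed.

(** * Finite Ramanujan expansion of the truncated divisor sum *)

Lemma sum_divisors_le (V : nmodType) (N m : nat) (h : nat -> V) : (0 < m)%N ->
  \sum_(q <- divisors m | (q <= N)%N) h q = \sum_(1 <= q < N.+1 | (q %| m)%N) h q.
Proof.
move=> m_gt0; rewrite (@sum_divisors _ m (N + m)) ?m_gt0 ?leq_addl //.
by rewrite [RHS](@big_nat_widen _ _ _ _ _ (N + m).+1) ?ltnS ?leq_addr.
Qed.

(** Write the indicator of [q | m] as [1 / q] times the sum of [c_l(m)] over [l | q], then collect
    the terms with equal [l]. *)
Lemma truncated_divisor_sumE (R : realType) (g : nat -> R[i]) (N m : nat) :
  (0 < m)%N ->
  truncated_divisor_sum g N m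
    = \sum_(1 <= l < N.+1) ramanujan_coef g N l * ramanujan_sum R l m.
Proof.
move=> m_gt0; rewrite /truncated_divisor_sum sum_divisors_le //.
under [RHS]eq_bigr do rewrite mulr_suml.
rewrite (exchange_big_dep xpredT) //= big_mkcond /=.
rewrite big_nat_cond [RHS]big_nat_cond; apply: eq_bigr => q /andP[/andP[q_gt0 qN] _].
rewrite -mulr_sumr.
have -> : \sum_(1 <= l < N.+1 | (l %| q)%N) ramanujan_sum R l m
    = \sum_(l <- divisors q) ramanujan_sum R l m.
  rewrite (@sum_divisors _ q N) ?q_gt0 //.
  by apply: eq_bigl => l; rewrite andbT.
rewrite sum_ramanujan_sum_divisors //; case: ifP => _; last by rewrite mulr0.
by rewrite divfK // pnatr_eq0 -lt0n.
Qed.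

(** * Absolute values and the tail of the Delange series *)

Lemma cabs_ge0 (R : realType) (z : R[i]) : 0 <= cabs z.
Proof. by case: z => x y; rewrite /= sqrtr_ge0. Qed.

Lemma cabs_nat (R : realType) (n : nat) : cabs (n%:R : R[i]) = n%:R.
Proof. by rewrite normcMn Normc.normc1. Qed.

Lemma cabs_sum (R : realType) (I : Type) (r : seq I) (P : pred I) (F : I -> R[i]) :
  cabs (\sum_(i <- r | P i) F i) <= \sum_(i <- r | P i) cabs (F i).
Proof.
elim/big_ind2: _ => // [|x1 x2 y1 y2 h1 h2]; first by rewrite Normc.normc0.
exact: le_trans (le_normcD _ _) (lerD h1 h2).
Qed.

(** The weights [2 ^ omega d] are at least 1, so the weighted series dominates. Its partial sums are
    bounded; [D] is an index where they come within [e] of their supremum. *)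
Lemma delange_tail (R : realType) (f h : nat -> R[i]) (N : nat) (e : R) :
  0 < e -> delange_hypothesis f h N ->
  exists D : nat, forall M : nat,
    \sum_(D.+1 <= d < M.+1) cabs (correlation' f h N d) / d%:R <= e.
Proof.
move=> e_gt0 summable; pose c d := cabs (correlation' f h N d).
pose w d : R := (2 ^ omega d)%:R / d%:R * c d.
have w_ge0 d : 0 <= w d by rewrite mulr_ge0 ?cabs_ge0 // divr_ge0 ?ler0n.
have w_ge d : c d / d%:R <= w d.
  rewrite /w mulrAC -[leRHS]mulrA ler_peMl ?divr_ge0 ?cabs_ge0 ?ler0n //.
  by rewrite ler1n expn_gt0.
pose s n := \sum_(1 <= d < n.+1) w d.
have [T sT] : exists T, forall n, s n <= T.
  move: summable; rewrite /delange_hypothesis.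
  set S := (X in (X < _)%E); move=> S_lt.
  have sS n : ((s n)%:E <= S)%E.
    rewrite /s -sumEFin.
    apply: (@nneseries_lim_ge R (fun d => (w d)%:E) xpredT 1 n.+1).
    by move=> d _ _; rewrite lee_fin.
  (* The value [+oo] contradicts the hypothesis, and [-oo] contradicts the lower bound by a partial
     sum. *)
  case: S S_lt sS => [T||] // _ sS; last by have := sS 0%N.
  by exists T => n; rewrite -lee_fin.
have sup_s : has_sup (range s).
  by split; [exists (s 0%N); exists 0%N | exists T => _ [n _ <-]].
have [_ [D _ <-] sD] := sup_adherent e_gt0 sup_s.
exists D => M; have [MD|DM] := leqP M D; first by rewrite big_geq // ltW.
apply: (@le_trans _ _ (\sum_(D.+1 <= d < M.+1) w d)); first by apply: ler_sum => d _; exact: w_ge.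
have sM : s M <= sup (range s) by apply: ub_le_sup; [case: sup_s | exists M].
have : s M = s D + \sum_(D.+1 <= d < M.+1) w d.
  by rewrite /s (@big_cat_nat _ _ _ D.+1) ?ltnS // ltnW.
by move=> sME; rewrite sME in sM; lra.
Qed.

(** * Averages over arithmetic progressions *)

Definition progression_count (d K L b : nat) : nat :=
  (\sum_(k < K) (d %| b + k * L))%N.

(** The quotients [(b + k L) / d] counted are distinct positive integers at most [(b + K L) / d].
    The bound is linear in [K], so that after division by [K] only a constant times [1 / d] remains,
    uniformly in [D]. *)
Lemma progression_count_bound (d K L b : nat) : (0 < d)%N -> (0 < b)%N ->
  (0 < K)%N -> (0 < L)%N ->
  (d * progression_count d K L b <= K * (b + L))%N.
Proof.
move=> d_gt0 b_gt0 K_gt0 L_gt0; rewrite /progression_count.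
pose t := [seq k <- iota 0 K | d %| b + k * L]%N.
have -> : (\sum_(k < K) (d %| b + k * L) = size t)%N.
  rewrite /t size_filter -sum1_count [RHS]big_mkcond /=.
  rewrite -(big_mkord xpredT (fun k => (d %| b + k * L)%N : nat)) /index_iota subn0.
  by apply: eq_bigr => k _; case: (d %| _)%N.
have le_t : (size t <= (b + K * L) %/ d)%N.
  rewrite -(size_map (fun k => (b + k * L) %/ d)%N) -[leqRHS](size_iota 1).
  apply: uniq_leq_size.
    rewrite map_inj_in_uniq ?filter_uniq ?iota_uniq // => x y.
    rewrite !mem_filter => /andP[dx _] /andP[dy _] /eqP.
    by rewrite -(eqn_pmul2r d_gt0) !divnK // eqn_add2l eqn_pmul2r // => /eqP.
  move=> x /mapP[k]; rewrite mem_filter mem_iota => /andP[dk /andP[_ kK]] ->.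
  rewrite mem_iota add1n ltnS divn_gt0 // dvdn_leq ?addn_gt0 ?b_gt0 //=.
  by rewrite leq_div2r // leq_add2l leq_mul2r ltnW ?orbT.
rewrite mulnC; apply: leq_trans (leq_mul le_t (leqnn d)) _.
apply: leq_trans (leq_trunc_div _ _) _.
by rewrite mulnDr leq_add2r leq_pmull.
Qed.

(** Lift [u] to [v = u + t L] prime to [L K]. Since [v] is prime to [d], [d | a + k L] iff [d]
    divides [v (a + k L) = u a + (t a + v k) L]. The map [k -> t a + v k] permutes residues modulo
    [K], and [d | K] makes divisibility depend on that residue only. *)
Lemma progression_count_unit (d K L u a : nat) :
  (0 < K)%N -> (0 < L)%N -> (0 < u)%N -> coprime u L -> (d %| K)%N ->
  progression_count d K L (u * a) = progression_count d K L a.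
Proof.
move=> K_gt0 L_gt0 u_gt0 co_uL dK.
have LK_gt0 : (0 < L * K)%N by rewrite muln_gt0 L_gt0.
have [t] := coprime_lift _ _ _ u_gt0 LK_gt0 co_uL.
set v := (u + t * L)%N; rewrite coprimeMr => /andP[_ co_vK].
rewrite /progression_count.
rewrite -(@sum_affine_mod nat K (t * a) v (fun k => (d %| u * a + k * L)%N : nat)) //.
apply: eq_bigr => k _; congr nat_of_bool.
rewrite -[RHS](@Gauss_dvdr d v) 1?coprime_sym ?(coprime_dvdr dK) //.
have -> : (v * (a + k * L) = u * a + (t * a + v * k) * L)%N by rewrite /v; ring.
rewrite {2}(divn_eq (t * a + v * k) K) mulnDl addnCA.
by rewrite [RHS]dvdn_addr // -mulnA dvdn_mull // dvdn_mulr.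
Qed.

(* Averaging F over the progression a + kL, k < K = D!, weighs F'(d) by the
   number of k with d | a + kL; for d <= D this number is unchanged when a is
   multiplied by a unit mod L, and the d > D contribute a tail of the series. *)
Lemma unit_invariance (R : realType) (F : nat -> R[i]) (L : nat) :
  (0 < L)%N -> (forall b, (0 < b)%N -> F (b + L)%N = F b) ->
  (forall e : R, 0 < e -> exists D : nat, forall M : nat,
    \sum_(D.+1 <= d < M.+1) cabs (eratosthenes F d) / d%:R <= e) ->
  forall u a, (0 < u)%N -> (0 < a)%N -> coprime u L -> F (u * a)%N = F a.
Proof.
move=> L_gt0 F_per tail u a u_gt0 a_gt0 co_uL; apply/eqP; rewrite -subr_eq0; apply/eqP.
apply: Normc.eq0_normc; apply/eqP; rewrite eq_le cabs_ge0 andbT.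
set c := cabs _; apply/ler_addgt0Pr => e e_gt0; rewrite add0r.
have ua_gt0 : (0 < u * a)%N by rewrite muln_gt0 u_gt0.
pose B := ((u * a + L) + (a + L))%N.
have B_gt0 : 0 < B%:R :> R by rewrite ltr0n /B !addn_gt0 ua_gt0.
(* [B] collects the bounds for the two counts and does not involve [K], so [D], and with it [K], may
   be chosen after it. The final estimate is [K B (e / B) = K e]. *)
have [D tailD] := tail _ (divr_gt0 e_gt0 B_gt0).
pose K := D`!; have K_gt0 : (0 < K)%N := fact_gt0 D.
(* [M] exceeds every term of both progressions, so one range of [d] serves for all. *)
pose M := (u * a + a + K * L)%N.
have mean b : (0 < b)%N -> (b <= u * a + a)%N ->
    K%:R * F b = \sum_(1 <= d < M.+1) (progression_count d K L b)%:R * eratosthenes F d.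
  move=> b_gt0 b_le.
  have F_perk k : F (b + k * L)%N = F b.
    elim: k => [|k IHk]; first by rewrite addn0.
    by rewrite mulSnr addnA F_per ?addn_gt0 ?b_gt0.
  transitivity (\sum_(k < K) \sum_(1 <= d < M.+1) (d %| b + k * L)%N%:R * eratosthenes F d).
    rewrite mulr_natl -{1}(card_ord K) -sumr_const; apply: eq_bigr => k _.
    rewrite -(F_perk k) -[LHS]sum_eratosthenes ?addn_gt0 ?b_gt0 //.
    rewrite (@sum_divisors _ _ M) ?addn_gt0 ?b_gt0 //=; last first.
      by rewrite /M leq_add // leq_mul2r ltnW ?orbT.
    rewrite big_mkcond; apply: eq_bigr => d _; rewrite andbT.
    by case: (d %| _)%N; rewrite ?mul1r ?mul0r.
  rewrite exchange_big; apply: eq_bigr => d _.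
  by rewrite /progression_count natr_sum mulr_suml.
have diff : K%:R * (F (u * a)%N - F a)
    = \sum_(D.+1 <= d < M.+1) ((progression_count d K L (u * a))%:R
        - (progression_count d K L a)%:R) * eratosthenes F d.
  rewrite mulrBr !mean ?leq_addr ?leq_addl // -sumrB.
  under eq_bigr do rewrite -mulrBl.
  (* Every [d <= D] divides [K = D!], so its two counts agree. *)
  have vanish d : (1 <= d)%N -> (d <= D)%N ->
      ((progression_count d K L (u * a))%:R - (progression_count d K L a)%:R)
        * eratosthenes F d = 0 :> R[i].
    move=> d_gt0 dD; rewrite progression_count_unit ?subrr ?mul0r //.
    by rewrite dvdn_fact // d_gt0.
  have [MD|DM] := leqP M D.
    rewrite [RHS]big_geq // big_nat big1 // => d /andP[d1 dM].
    by rewrite vanish // (leq_trans _ MD).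
  rewrite (@big_cat_nat _ _ _ D.+1) ?ltnS ?(ltnW DM) //= big_nat big1 ?add0r //.
  by move=> d /andP[d1 dD]; rewrite vanish.
have term d : (0 < d)%N ->
    cabs (((progression_count d K L (u * a))%:R - (progression_count d K L a)%:R)
       * eratosthenes F d)
    <= (K * B)%:R * (cabs (eratosthenes F d) / d%:R).
  move=> d_gt0; rewrite Normc.normcM [leRHS]mulrA [leRHS]mulrAC.
  rewrite ler_wpM2r ?cabs_ge0 //.
  apply: le_trans (le_normcD _ _) _; rewrite normcN !cabs_nat -natrD.
  rewrite ler_pdivlMr ?ltr0n // -natrM ler_nat mulnC mulnDr /B mulnDr.
  by rewrite leq_add // progression_count_bound.
have K0 : 0 < K%:R :> R by rewrite ltr0n.
rewrite -(ler_pM2l K0) /c -[X in X * cabs _]cabs_nat -Normc.normcM diff.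
apply: le_trans (cabs_sum _ _ _ _ _) _.
apply: (@le_trans _ _ (\sum_(D.+1 <= d < M.+1) (K * B)%:R * (cabs (eratosthenes F d) / d%:R))).
  rewrite big_nat [leRHS]big_nat; apply: ler_sum => d /andP[dD _].
  by rewrite term // (leq_trans _ dD).
rewrite -mulr_sumr natrM -mulrA ler_wpM2l ?ler0n //.
by rewrite mulrC -ler_pdivlMr.
Qed.

(** * The exact formula for the truncated correlation *)

Lemma correlation_truncated_periodic (R : realType) (f g : nat -> R[i]) (N L b : nat) :
  (forall l, (0 < l <= N)%N -> (l %| L)%N) -> (0 < b)%N ->
  correlation f (truncated_divisor_sum g N) N (b + L)
    = correlation f (truncated_divisor_sum g N) N b.
Proof.
move=> dvdL b_gt0; apply: eq_bigr => n _; congr (_ * _).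
rewrite !truncated_divisor_sumE ?addn_gt0 ?b_gt0 ?orbT //.
rewrite big_nat [RHS]big_nat; apply: eq_bigr => l lN; congr (_ * _).
have /andP[l_gt0 _] := lN; apply: ramanujan_sum_mod => //.
by rewrite addnA -modnDmr (eqP (dvdL _ lN)) addn0.
Qed.

Lemma ramanujan_exact_formula (R : realType) (f g : nat -> R[i]) (N a : nat) :
  delange_hypothesis f (truncated_divisor_sum g N) N -> (0 < a)%N ->
  correlation f (truncated_divisor_sum g N) N a
    = \sum_(1 <= l < N.+1)
        (ramanujan_coef g N l / (totient l)%:R
          * \sum_(1 <= n < N.+1) f n * ramanujan_sum R l n)
        * ramanujan_sum R l a.
Proof.
move=> summable a_gt0; set F := correlation f _ N; set L := N`!.
have L_gt0 : (0 < L)%N := fact_gt0 N.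
have dvdL l : (0 < l <= N)%N -> (l %| L)%N by apply: dvdn_fact.
have F_unit u : (0 < u)%N -> coprime u L -> F (u * a)%N = F a.
  move=> u_gt0 co_uL; apply: (@unit_invariance _ _ L) => // [b|e e_gt0].
    exact: correlation_truncated_periodic.
  exact: delange_tail.
have totL0 : (totient L)%:R != 0 :> R[i] by rewrite pnatr_eq0 -lt0n totient_gt0.
(* Multiplied by the totient of [L], the value [F a] becomes the sum of [F (u * a)] over the units
   [u]. *)
apply: (mulfI totL0); rewrite -count_units // mulr_suml.
transitivity (\sum_(1 <= u < L.+1 | coprime u L) F (u * a)%N).
  rewrite big_nat_cond [RHS]big_nat_cond.
  by apply: eq_bigr => u /andP[/andP[u_gt0 _] co_uL]; rewrite mul1r F_unit.
rewrite count_units //.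
transitivity (\sum_(1 <= u < L.+1 | coprime u L) \sum_(1 <= l < N.+1)
    \sum_(1 <= n < N.+1) ramanujan_coef g N l * f n * ramanujan_sum R l (n + u * a)).
  rewrite big_nat_cond [RHS]big_nat_cond.
  apply: eq_bigr => u /andP[/andP[u_gt0 _] _]; rewrite exchange_big.
  apply: eq_bigr => n _.
  rewrite truncated_divisor_sumE ?addn_gt0 ?muln_gt0 ?u_gt0 ?a_gt0 ?orbT //.
  by rewrite mulr_sumr; apply: eq_bigr => l _; rewrite mulrCA mulrA.
rewrite exchange_big mulr_sumr /= big_nat [RHS]big_nat; apply: eq_bigr => l lN.
have /andP[l_gt0 _] := lN.
rewrite exchange_big /=.
transitivity (\sum_(1 <= n < N.+1) (totient L)%:R * (ramanujan_coef g N l / (totient l)%:R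
    * (f n * ramanujan_sum R l n) * ramanujan_sum R l a)); last first.
  by rewrite -mulr_sumr -mulr_suml -mulr_sumr.
apply: eq_bigr => n _; rewrite -mulr_sumr.
have totl0 : (totient l)%:R != 0 :> R[i] by rewrite pnatr_eq0 -lt0n totient_gt0.
apply: (mulfI totl0); rewrite mulrCA sum_units_ramanujan_sum ?dvdL //.
by field.
Qed.

(** * The truncation error *)

Lemma moebius_le1 (R : realType) (n : nat) : cabs (moebius R n) <= 1.
Proof.
rewrite /moebius; case: ifP => _; last by rewrite Normc.normc0.
rewrite -signr_odd; case: odd; rewrite ?expr1 ?expr0 ?normcN Normc.normc1 //.
Qed.

Lemma ramanujan_conjecture_ge0 (R : realType) (A : R -> R) (f : nat -> R[i]) (e : R) :
  0 < e -> ramanujan_conjecture_with A f -> 0 <= A e.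
Proof.
move=> e_gt0 /(_ e e_gt0 1%N isT); rewrite powR1 mulr1.
by apply: le_trans; exact: cabs_ge0.
Qed.

(** Half of the exponent pays for the number of divisors, half for the values of [g]. [B] is fixed
    before [g], which keeps the final constant uniform. *)
Lemma eratosthenes_bound (R : realType) (A : R -> R) (e : R) : 0 < e ->
  exists B : R, forall g : nat -> R[i], ramanujan_conjecture_with A g ->
    forall q : nat, (0 < q)%N -> cabs (eratosthenes g q) <= B * q%:R `^ e.
Proof.
move=> e_gt0; have e2_gt0 : 0 < e / 2 by rewrite divr_gt0.
have [C C_ge0 tauC] := divisor_bound R (e / 2) e2_gt0.
exists (C * A (e / 2)) => g gA q q_gt0.
have A_ge0 := ramanujan_conjecture_ge0 _ _ _ _ e2_gt0 gA.
apply: le_trans (cabs_sum _ _ _ _ _) _.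
apply: (@le_trans _ _ (\sum_(d <- divisors q) A (e / 2) * q%:R `^ (e / 2))).
  rewrite big_seq [leRHS]big_seq; apply: ler_sum => d; rewrite -dvdn_divisors // => dq.
  have d_gt0 := dvdn_gt0 q_gt0 dq.
  rewrite Normc.normcM -[leRHS]mulr1 ler_pM ?cabs_ge0 ?moebius_le1 //.
  apply: le_trans (gA _ e2_gt0 _ d_gt0) _; rewrite ler_wpM2l //.
  by rewrite ge0_ler_powR ?nnegrE ?ler0n ?(ltW e2_gt0) // ler_nat dvdn_leq.
rewrite big_const_seq count_predT iter_addr_0 -[leLHS]mulr_natl.
apply: le_trans (ler_wpM2r _ (tauC _ q_gt0)) _; first by rewrite mulr_ge0 ?powR_ge0.
have -> : q%:R `^ e = q%:R `^ (e / 2) * q%:R `^ (e / 2) :> R.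
  by rewrite -powRD -?splitr // pnatr_eq0 -lt0n q_gt0 implybT.
by rewrite le_eqVlt; apply/orP; left; apply/eqP; ring.
Qed.

Lemma divisor_sum_tail (R : realType) (g : nat -> R[i]) (N m : nat) : (0 < m)%N ->
  g m - truncated_divisor_sum g N m
    = \sum_(N.+1 <= q < m.+1 | (q %| m)%N) eratosthenes g q.
Proof.
move=> m_gt0; rewrite -[g m]sum_eratosthenes //.
rewrite (bigID (fun q => q <= N)%N) /= addrC addrK.
rewrite (@sum_divisors _ m m) ?m_gt0 ?leqnn //.
rewrite [RHS](@big_nat_widenl _ _ _ _ 1) //.
by apply: eq_bigl => q; rewrite ltnNge.
Qed.

(** The integers [n <= N < q] are pairwise incongruent modulo [q]. *)
Lemma multiples_le1 (N q a : nat) : (N < q)%N ->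
  (\sum_(1 <= n < N.+1 | q %| n + a) 1 <= 1)%N.
Proof.
move=> Nq; rewrite sum1_count -size_filter.
have: uniq [seq n <- index_iota 1 N.+1 | q %| n + a]%N by rewrite filter_uniq ?iota_uniq.
have: forall n, n \in [seq n <- index_iota 1 N.+1 | q %| n + a]%N ->
    (n <= N)%N /\ (q %| n + a)%N.
  by move=> n; rewrite mem_filter mem_index_iota ltnS => /andP[-> /andP[_ ->]].
case: [seq n <- _ | _] => [|x [|y s]] // memP /=.
have [xN qx] := memP x (mem_head _ _).
have [yN qy] : (y <= N)%N /\ (q %| y + a)%N by apply: memP; rewrite !inE eqxx orbT.
rewrite inE => /andP[/norP[/eqP xy _] _]; case: xy.
have : (x + a = y + a %[mod q])%N by rewrite (eqP qx) (eqP qy).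
move/eqP; rewrite eqn_modDr !modn_small ?(leq_ltn_trans _ Nq) //.
by move/eqP.
Qed.

(** Only divisors [q] of [n + a] with [N < q <= N + a] are lost. Summing over [n] first, each of
    these [a] values of [q] occurs at most once. *)
Lemma correlation_truncation_error (R : realType) (f g : nat -> R[i]) (N a : nat)
    (Bf Bg : R) : 0 <= Bf -> 0 <= Bg ->
  (forall n, (0 < n <= N)%N -> cabs (f n) <= Bf) ->
  (forall q, (0 < q <= N + a)%N -> cabs (eratosthenes g q) <= Bg) ->
  cabs (correlation f g N a - correlation f (truncated_divisor_sum g N) N a)
    <= Bf * Bg * a%:R.
Proof.
move=> Bf_ge0 Bg_ge0 fB gB; rewrite /correlation -sumrB.
apply: le_trans (cabs_sum _ _ _ _ _) _.
apply: (@le_trans _ _ (\sum_(1 <= n < N.+1)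
    \sum_(N.+1 <= q < (N + a).+1 | (q %| n + a)%N) Bf * Bg)).
  rewrite big_nat [leRHS]big_nat; apply: ler_sum => n /andP[n_gt0 nN].
  rewrite -mulrBr divisor_sum_tail ?addn_gt0 ?n_gt0 // Normc.normcM -mulr_sumr.
  rewrite ler_pM ?cabs_ge0 ?fB ?n_gt0 //.
  apply: le_trans (cabs_sum _ _ _ _ _) _.
  (* The upper limit [n + a] is raised to [N + a], making the range of [q] independent of [n] so
     that the sums can be exchanged. *)
  rewrite (@big_nat_widen _ _ _ _ (n + a).+1 (N + a).+1) ?ltnS ?leq_add2r //=.
  rewrite big_nat_cond [leRHS]big_nat_cond.
  apply: (@le_trans _ _ (\sum_(N.+1 <= q < (N + a).+1 |
       (N < q < (N + a).+1)%N && ((q %| n + a)%N && (q < (n + a).+1)%N)) Bg)).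
    apply: ler_sum => q /andP[/andP[Nq qNa] _].
    by rewrite gB // (leq_ltn_trans _ Nq).
  rewrite big_mkcond [leRHS]big_mkcond; apply: ler_sum => q _ /=.
  case: (N < q < _)%N => //=; case: (q %| _)%N => //=.
  by case: ifP.
rewrite (exchange_big_dep xpredT) //=.
apply: (@le_trans _ _ (\sum_(N.+1 <= q < (N + a).+1) Bf * Bg)).
  rewrite big_nat [leRHS]big_nat; apply: ler_sum => q /andP[Nq _].
  have -> : \sum_(1 <= n < N.+1 | (q %| n + a)%N) Bf * Bg
      = Bf * Bg * (\sum_(1 <= n < N.+1 | q %| n + a) 1)%N%:R.
    by rewrite natr_sum mulr_sumr; apply: eq_bigr => n _; rewrite mulr1.
  by rewrite ler_piMr ?mulr_ge0 // lern1 multiples_le1.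
by rewrite sumr_const_nat subSS addKn mulr_natr.
Qed.

(* The constant K depends only on eps and on the constants in the Ramanujan
   Conjecture bounds; it is uniform in f, g, N and a. *)
Theorem mainTheorem1 (R : realType) (Af Ag : R -> R) (eps : R) (eps_gt0 : 0 < eps) :
  exists K : R,
  forall f g : nat -> R[i],
    ramanujan_conjecture_with Af f ->
    ramanujan_conjecture_with Ag g ->
  forall N : nat, (0 < N)%N ->
    delange_hypothesis f (truncated_divisor_sum g N) N ->
  forall a : nat, (0 < a)%N ->
    cabs (correlation f g N a
          - \sum_(1 <= l < N.+1)
              (ramanujan_coef g N l / (totient l)%:R
                * \sum_(1 <= n < N.+1) f n * ramanujan_sum R l n)
              * ramanujan_sum R l a)
    <= K * (N%:R `^ eps * (N + a)%:R `^ eps * a%:R).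
Proof.
have [B gB] := eratosthenes_bound R Ag eps eps_gt0.
(* [Af eps] comes from [f] and [B] from [g']; the powers are taken at the largest arguments, [N] for
   [n] and [N + a] for [q]. *)
exists (Af eps * B) => f g fR gR N N_gt0 summable a a_gt0.
have Af_ge0 := ramanujan_conjecture_ge0 _ _ _ _ eps_gt0 fR.
have B_ge0 : 0 <= B.
  have := gB g gR 1%N isT; rewrite powR1 mulr1.
  by apply: le_trans; exact: cabs_ge0.
have mono m n : (m <= n)%N -> m%:R `^ eps <= n%:R `^ eps :> R.
  by move=> mn; rewrite ge0_ler_powR ?nnegrE ?ler0n ?(ltW eps_gt0) // ler_nat.
rewrite -ramanujan_exact_formula //.
apply: le_trans (@correlation_truncation_error R f g N a (Af eps * N%:R `^ eps)
  (B * (N + a)%:R `^ eps) _ _ _ _) _; rewrite ?mulr_ge0 ?powR_ge0 //.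
- move=> n /andP[n_gt0 nN]; apply: le_trans (fR _ eps_gt0 _ n_gt0) _.
  by rewrite ler_wpM2l // mono.
- move=> q /andP[q_gt0 qN]; apply: le_trans (gB _ gR _ q_gt0) _.
  by rewrite ler_wpM2l // mono.
by rewrite le_eqVlt; apply/orP; left; apply/eqP; ring.
Qed.
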